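(* For all $n\ge 3$, $$\mathrm{ex}_\circlearrowright(n,D_1)=\Delta^{\bullet}(n),\qquad \mathrm{ex}_\circlearrowright(n,S_1)=\Delta^{\bullet}(n)+\Big\lfloor\frac n2\Big\rfloor\Big\lfloor\frac{n-2}{2}\Big\rfloor,\qquad \mathrm{ex}_\circlearrowright(n,M_1)=\Delta^{\bullet}(n)+\frac{n(n-3)}{2}.$$
   Context: $\Omega_n=\{v_0,\dots,v_{n-1}\}$ is the vertex set of a regular $n$-gon with the clockwise cyclic ordering. We write $x_1<x_2<\dots<x_k<x_1$ to mean that $x_1,\dots,x_k$ are distinct and occur in this clockwise cyclic order. A convex geometric hypergraph (cgh) on $\Omega_n$ is a set $H$ of $3$-element subsets (edges, or triangles) of $\Omega_n$. A cgh $H$ contains a cgh $F$ if there is an injection from the vertex set of $F$ to the vertex set of $H$ preserving the cyclic ordering and mapping edges to edges; otherwise $H$ is $F$-free. $\mathrm{ex}_\circlearrowright(n,F)$ is the maximum number of edges in an $F$-free cgh on $\Omega_n$. The configurations are the following cghs with two edges: - $D_1$: $\{x_1,x_2,x_3\},\{x_1,x_3,x_4\}$ with $x_1<x_2<x_3<x_4<x_1$ (two triangles sharing a side and lying on opposite sides of it). - $S_1$: $\{x_1,x_2,x_3\},\{x_1,x_4,x_5\}$ with $x_1<x_2<x_3<x_4<x_5<x_1$ (two triangles meeting exactly in one common vertex). - $M_1$: $\{x_1,x_2,x_3\},\{x_4,x_5,x_6\}$ with $x_1<x_2<\dots<x_6<x_1$ (two geometrically disjoint triangles). Finally, $\Delta^{\bullet}(n)=\frac{n(n-1)(n+1)}{24}$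 if $n$ is odd and $\Delta^{\bullet}(n)=\frac{n(n-2)(n+2)}{24}$ if $n$ is even. *)

(* Defs.v *)
From mathcomp Require Import all_boot.
Set Implicit Arguments.
Unset Strict Implicit.
Unset Printing Implicit Defensive.

(* The vertex v_i of Omega_n is i : 'I_n, numbered clockwise, so that the
   clockwise cyclic order x < y < z < x is increasing order up to rotation. *)
Definition cyc_order n (x y z : 'I_n) : bool :=
  [|| x < y < z, y < z < x | z < x < y].

Definition is_cgh n (H : {set {set 'I_n}}) : bool :=
  [forall e in H, #|e| == 3].

Definition cyc_preserving k n (f : 'I_k -> 'I_n) : bool :=
  [forall x, forall y, forall z,
     cyc_order x y z ==> cyc_order (f x) (f y) (f z)].

Definition cgh_contains n k (H : {set {set 'I_n}}) (F : {set {set 'I_k}}) :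
    bool :=
  [exists f : {ffun 'I_k -> 'I_n},
     [&& injectiveb f, cyc_preserving f & [forall e in F, f @: e \in H]]].

Definition ex_cyc n k (F : {set {set 'I_k}}) : nat :=
  \max_(H : {set {set 'I_n}} | is_cgh H && ~~ cgh_contains H F) #|H|.

Definition triangle k (i j l : nat) : {set 'I_k.+1} :=
  [set inord i; inord j; inord l].

(* A configuration with vertices x_1 < ... < x_k < x_1 is taken on the vertex
   set 'I_k, with x_(i+1) represented by i. *)
Definition D1 : {set {set 'I_4}} := [set triangle 3 0 1 2; triangle 3 0 2 3].
Definition S1 : {set {set 'I_5}} := [set triangle 4 0 1 2; triangle 4 0 3 4].
Definition M1 : {set {set 'I_6}} := [set triangle 5 0 1 2; triangle 5 3 4 5].

(* Both divisions by 24 are exact, and a truncated n - 1 or n - 2 only occurs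
   for n = 0, where the product vanishes anyway. *)
Definition Delta_bullet (n : nat) : nat :=
  if odd n then (n * (n - 1) * (n + 1)) %/ 24
  else (n * (n - 2) * (n + 2)) %/ 24.

(* Main.v *)
Require Import Defs.
From mathcomp Require Import all_boot zify.

(* Let O be an antisymmetric relation on the n vertices. Any 3-set has at most
   one vertex x with the other two in O x, so a family of 3-sets without such a
   vertex has at most C(n,3) - sum_x C(|O x|,2) members; this is a convexity
   bound once sum_x |O x| is known, and for a tournament it is Delta(n).
   - D1: let x -> y when some triangle xyz of H has z clockwise beyond y. H is
     D1-free exactly when this is antisymmetric; then complete it to a
     tournament, in which every triangle of H is cyclic.
   - S1: in an S1-free H the chords with triangles on both sides form a
     matching. Deleting for each of them the side with fewer triangles, at most
     (n-2)/2 of them, leaves a D1-free family.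
   - M1: of the two arcs [p,q) and [q,p) at most one contains a triangle of H;
     declare one that contains none small. Put y in O x when [x,y] is small:
     only the n singleton arcs are lost in comparison with a tournament, whence
     the additional n(n-3)/2.
   For the lower bounds take all triangles such that, for each vertex x, the
   last of the other two vertices is at clockwise distance more than h x, where
   h is constant or takes two consecutive values. *)

Set Implicit Arguments.
Unset Strict Implicit.
Unset Printing Implicit Defensive.

(** * Clockwise distance and cyclic order *)

Definition cdist n (x y : 'I_n) : nat := if x <= y then y - x else y + n - x.

Lemma cdistP n (x y : 'I_n) :
  (x <= y /\ cdist x y + x = y) \/ (y < x /\ cdist x y + x = y + n).
Proof. by rewrite /cdist; have := ltn_ord x; case: (leqP x y); lia. Qed.

Lemma cdist_inj n (p : 'I_n) : injective (cdist p).
Proof.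
move=> x y E; apply: val_inj => /=; have := cdistP p x; have := cdistP p y.
by have := ltn_ord x; have := ltn_ord y; lia.
Qed.

(** Rotating [p] to 0 changes no cyclic order, so cyclic questions become linear ones about
    distances from any convenient base point. *)
Lemma cyc_order_cdist n (p x y z : 'I_n) :
  cyc_order x y z = [|| cdist p x < cdist p y < cdist p z,
    cdist p y < cdist p z < cdist p x | cdist p z < cdist p x < cdist p y].
Proof.
rewrite /cyc_order; have := cdistP p x; have := cdistP p y; have := cdistP p z.
by have := ltn_ord x; have := ltn_ord y; have := ltn_ord z; lia.
Qed.

Lemma cdistxx n (x : 'I_n) : cdist x x = 0.
Proof. by rewrite /cdist leqnn subnn. Qed.

Lemma cyc_order_cdistx n (x y z : 'I_n) :
  cyc_order x y z = (0 < cdist x y < cdist x z).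
Proof. by rewrite (cyc_order_cdist x) cdistxx; lia. Qed.

Lemma cyc_order_rot n (x y z : 'I_n) : cyc_order x y z = cyc_order y z x.
Proof. by rewrite /cyc_order; lia. Qed.

Lemma ord_neq_ltn n (x y : 'I_n) : (x != y) = (x < y) || (y < x).
Proof. exact: neq_ltn. Qed.

Lemma set3_rot (T : finType) (x y z : T) : [set x; y; z] = [set y; z; x].
Proof. by apply/setP => w; rewrite !inE; do !case: eqP. Qed.

Lemma card3_sort n (p : 'I_n) (e : {set 'I_n}) : #|e| = 3 ->
  exists x y z, e = [set x; y; z] /\ cdist p x < cdist p y < cdist p z.
Proof.
move=> ce; pose s := sort (relpre (cdist p) leq) (enum e).
have ss : sorted (relpre (cdist p) leq) s.
  by apply: sort_sorted => x y; apply: leq_total.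
have us : uniq s by rewrite sort_uniq enum_uniq.
have ms : e =i s by move=> x; rewrite mem_sort mem_enum.
have : size s = 3 by rewrite size_sort -cardE.
case: s ss us ms => [|x [|y [|z []]]] //= /and3P[xy yz _].
rewrite !inE negb_or => /andP[/andP[nxy nxz] /andP[nyz _]] ms _.
exists x, y, z; split; first by apply/setP => w; rewrite ms !inE orbA.
by rewrite !ltn_neqAle xy yz !(inj_eq (@cdist_inj _ p)) nxy nyz.
Qed.

Lemma card3_cyc n (x : 'I_n) (e : {set 'I_n}) : #|e| = 3 -> x \in e ->
  exists y z, e = [set x; y; z] /\ cyc_order x y z.
Proof.
move=> ce; case: (card3_sort x ce) => a [b [c [-> abc]]] xe.
suff E : x = a by subst; exists b, c; rewrite cyc_order_cdistx -{1}(cdistxx a).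
move: xe; rewrite !inE => /orP[/orP[]|] /eqP // E; move: abc;
  by rewrite E cdistxx ltn0 ?andbF.
Qed.

(** * Containment of a configuration of two triangles *)

Lemma contains_sorted n k (H : {set {set 'I_n}}) (t : k.+1.-tuple 'I_n)
    (p : 'I_n) i1 i2 i3 j1 j2 j3 :
  sorted (relpre (cdist p) ltn) t ->
  all (leq^~ k) [:: i1; i2; i3; j1; j2; j3] ->
  [set nth p t i1; nth p t i2; nth p t i3] \in H ->
  [set nth p t j1; nth p t j2; nth p t j3] \in H ->
  cgh_contains H [set triangle k i1 i2 i3; triangle k j1 j2 j3].
Proof.
move=> st /and5P[i1k i2k i3k j1k /and3P[j2k j3k _]] h1 h2.
have mono (i j : 'I_k.+1) : i < j -> cdist p (tnth t i) < cdist p (tnth t j).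
  move=> ij; rewrite !(tnth_nth p).
  apply: (sorted_ltn_nth _ p st); rewrite ?inE ?size_tuple //.
  by move=> a b c /=; apply: ltn_trans.
apply/existsP; exists [ffun i => tnth t i]; apply/and3P; split.
- apply/injectiveP => i j; rewrite !ffunE => E.
  case: (ltngtP i j) => [/mono|/mono|/val_inj //]; by rewrite E ltnn.
- apply/forallP => i; apply/forallP => j; apply/forallP => l; apply/implyP.
  rewrite (cyc_order_cdist p) !ffunE /cyc_order.
  case/or3P => /andP[a b]; rewrite !(mono _ _ a, mono _ _ b) ?orbT //.
- apply/forallP => e; apply/implyP; rewrite !inE.
  by case/orP => /eqP ->;
    rewrite /triangle !imsetU !imset_set1 !ffunE !(tnth_nth p) !inordK.
Qed.

Lemma containsP n k (H : {set {set 'I_n}}) i1 i2 i3 j1 j2 j3 :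
  cgh_contains H [set triangle k i1 i2 i3; triangle k j1 j2 j3] ->
  exists g : nat -> 'I_n,
    [/\ forall i j l, i < j < l -> l <= k -> cyc_order (g i) (g j) (g l),
        [set g i1; g i2; g i3] \in H & [set g j1; g j2; g j3] \in H].
Proof.
case/existsP => f /and3P[_ cp /forallP fH].
have im a b c : f @: triangle k a b c
    = [set f (inord a); f (inord b); f (inord c)].
  by rewrite /triangle !imsetU !imset_set1.
exists (fun i => f (inord i)); split=> [i j l ijl lk||].
- move/forallP/(_ (inord i))/forallP/(_ (inord j))/forallP/(_ (inord l)): cp.
  move/implyP; apply; rewrite /cyc_order !inordK ?ijl //; lia.
- by have := fH (triangle k i1 i2 i3); rewrite im !inE eqxx.
- by have := fH (triangle k j1 j2 j3); rewrite im !inE eqxx orbT.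
Qed.

(** * Counting 3-sets by stars *)

Definition star (T : finType) (x : T) (A : {set T}) : {set {set T}} :=
  [set e : {set T} | [&& #|e| == 3, x \in e & e :\ x \subset A]].

Lemma card_star (T : finType) (x : T) (A : {set T}) :
  x \notin A -> #|star x A| = 'C(#|A|, 2).
Proof.
move=> xA; rewrite -(cards_draws A 2).
set D := [set B : {set T} | _].
suff -> : star x A = [set x |: B | B in D].
  rewrite card_in_imset // => B C; rewrite !inE => /andP[BA _] /andP[CA _] E.
  have nx (F : {set T}) : F \subset A -> x \notin F.
    by move/subsetP=> h; apply: contra xA => /h.
  by rewrite -(setU1K (nx _ BA)) E setU1K // nx.
apply/setP => e; rewrite inE; apply/and3P/imsetP => [[c3 xe eA]|[B]].
  exists (e :\ x); last by rewrite setD1K.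
  by rewrite inE eA; move: c3; rewrite (cardsD1 x) xe.
rewrite inE => /andP[BA cB] ->.
have xB : x \notin B by apply: contra xA; apply: (subsetP BA).
by rewrite cardsU1 xB (eqP cB) setU11 setU1K.
Qed.

(** Stars at distinct [x] and [y] are disjoint: a common member would force both [r x y] and
    [r y x]. *)
Lemma star_packing n (H : {set {set 'I_n}}) (r : rel 'I_n) :
  is_cgh H -> (forall x y, r x y -> ~~ r y x) ->
  (forall x e, e \in H -> e \notin star x [set y | r x y]) ->
  #|H| + \sum_x 'C(#|[set y | r x y]|, 2) <= 'C(n, 3).
Proof.
move=> /forallP cH ra Hr; pose S x := star x [set y | r x y].
have irr x : x \notin [set y | r x y].
  by rewrite inE; apply/negP => h; have := ra _ _ h; rewrite h.
have -> : \sum_x 'C(#|[set y | r x y]|, 2) = #|\bigcup_x S x|.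
  rewrite -sum1_card partition_disjoint_bigcup => [|x y xy].
    by apply: eq_bigr => x _; rewrite sum1_card card_star.
  rewrite -setI_eq0; apply/eqP/setP => e; rewrite !inE.
  apply/negP => /andP[/and3P[_ xe ex] /and3P[_ ye ey]].
  have := subsetP ex y; rewrite !inE eq_sym xy ye => /(_ isT) rxy.
  have := subsetP ey x; rewrite !inE xy xe => /(_ isT) ryx.
  by have := ra _ _ rxy; rewrite ryx.
have dis : H :&: \bigcup_x S x = set0.
  apply/setP => e; rewrite !inE; apply/negP => /andP[eH /bigcupP[x _]].
  by apply/negP/Hr.
rewrite -cardsUI dis cards0 addn0 -[n in 'C(n, _)]card_ord -card_draws.
apply: subset_leq_card; apply/subsetP => e; rewrite !inE => /orP[eH|].
  by have := cH e; rewrite eH.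
by case/bigcupP => x _; rewrite inE => /and3P[].
Qed.

Lemma star_covering n (A : 'I_n -> {set 'I_n}) :
  (forall x, x \notin A x) ->
  'C(n, 3) <= #|[set e : {set 'I_n} | #|e| == 3] :\: \bigcup_x star x (A x)|
              + \sum_x 'C(#|A x|, 2).
Proof.
move=> irr; have -> : \sum_x 'C(#|A x|, 2) = \sum_x #|star x (A x)|.
  by apply: eq_bigr => x _; rewrite card_star.
rewrite -[n in 'C(n, _)]card_ord -card_draws.
rewrite -(cardsID (\bigcup_x star x (A x))) addnC leq_add2l.
apply: leq_trans (subset_leq_card (subsetIr _ _)) _.
elim/big_ind2: _ => [|B a C b hB hC|//]; first by rewrite cards0.
by apply: leq_trans (leq_add hB hC); rewrite cardsU leq_subr.
Qed.

(** * Convexity, tournaments and [Delta_bullet] *)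

Lemma bin2_sqr m : 'C(m, 2) * 2 + m = m * m.
Proof. by elim: m => // m IH; rewrite binS bin1; nia. Qed.

Lemma bin3_cube m : 'C(m, 3) * 6 + 3 * (m * m) = m * m * m + 2 * m.
Proof. by elim: m => // m IH; rewrite binS; have := bin2_sqr m; nia. Qed.

(** The line of slope k through (k, C(k,2)) supports the convex sequence C(d,2), with equality at d
    = k and d = k + 1. *)
Lemma bin2_tangent k d : 'C(k, 2) + k * d <= 'C(d, 2) + k * k.
Proof.
by have := bin2_sqr k; have := bin2_sqr d; case: (leqP d k); nia.
Qed.

Lemma sum_bin2_tangent (T : finType) (d : T -> nat) k :
  #|T| * 'C(k, 2) + k * \sum_x d x <= \sum_x 'C(d x, 2) + #|T| * (k * k).
Proof.
rewrite big_distrr /= -!sum_nat_const -!big_split /=.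
by apply: leq_sum => x _; apply: bin2_tangent.
Qed.

Definition completion n (r : rel 'I_n) : rel 'I_n :=
  fun x y => r x y || ~~ r y x && (x < y).

Lemma completion_antisym n (r : rel 'I_n) :
  (forall x y, r x y -> ~~ r y x) ->
  forall x y, completion r x y -> ~~ completion r y x.
Proof.
move=> ra x y; rewrite /completion.
have := ra x y; have := ra y x; case: (r x y); case: (r y x); lia.
Qed.

Lemma sum_outdeg_completion n (r : rel 'I_n) :
  (forall x y, r x y -> ~~ r y x) ->
  (\sum_x #|[set y | completion r x y]|) * 2 + n = n * n.
Proof.
move=> ra.
have E : \sum_x #|[set y | completion r x y]|
    = \sum_x \sum_y (completion r x y : nat).
  apply: eq_bigr => x _; rewrite -sum1_card big_mkcond /=.
  by apply: eq_bigr => y _; rewrite inE; case: completion.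
have row x : \sum_y (completion r x y + completion r y x) = n.-1.
  rewrite (bigD1 x) //= -[in RHS](card_ord n) (cardD1 x) inE -sum1_card /=.
  have -> : completion r x x = false.
    by apply/negP => h; have := completion_antisym ra h; rewrite h.
  apply: eq_big => [y|y yx]; first by rewrite !inE andbT.
  move: yx; rewrite ord_neq_ltn /completion; have := ra x y; have := ra y x.
  case: (r x y); case: (r y x) => //=; lia.
rewrite muln2 -addnn {2}E exchange_big {}E -big_split /=.
under eq_bigr => x _ do rewrite -big_split row.
by rewrite sum_nat_const card_ord; case: n {r ra row} => // n; lia.
Qed.

(** A regular tournament on 2m + 1 vertices has all out-degrees m; [Delta_bullet] counts its cyclic
    triples. *)
Lemma Delta_bulletE_odd m :
  Delta_bullet m.*2.+1 + m.*2.+1 * 'C(m, 2) = 'C(m.*2.+1, 3).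
Proof.
rewrite /Delta_bullet /= odd_double /=.
have le : m.*2.+1 * 'C(m, 2) <= 'C(m.*2.+1, 3).
  by have := bin3_cube m.*2.+1; have := bin2_sqr m; nia.
rewrite -[RHS](subnK le); congr (_ + _).
rewrite (_ : _ * _ * _ = ('C(m.*2.+1, 3) - m.*2.+1 * 'C(m, 2)) * 24) ?mulnK //.
by move: le; have := bin3_cube m.*2.+1; have := bin2_sqr m; nia.
Qed.

(** In a most balanced tournament on 2m + 2 vertices half of the out-degrees are m + 1 and half are
    m. *)
Lemma Delta_bulletE_even m :
  Delta_bullet m.+1.*2 + m.+1 * ('C(m.+1, 2) + 'C(m, 2)) = 'C(m.+1.*2, 3).
Proof.
have -> : 'C(m.+1, 2) + 'C(m, 2) = m * m.
  by rewrite binS bin1; have := bin2_sqr m; lia.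
have := bin3_cube m.+1.*2; rewrite /Delta_bullet odd_double.
set C := 'C(_, 3) => EC.
have le : m.+1 * (m * m) <= C by nia.
rewrite -[RHS](subnK le); congr (_ + _).
rewrite (_ : _ * _ * _ = (C - m.+1 * (m * m)) * 24) ?mulnK //.
by nia.
Qed.

Lemma sum_bin2_ge n (d : 'I_n -> nat) k b :
  n * k + b <= \sum_x d x -> n * 'C(k, 2) + k * b <= \sum_x 'C(d x, 2).
Proof.
move=> hd; have := sum_bin2_tangent d k; rewrite card_ord.
have : k * (n * k + b) <= k * \sum_x d x by rewrite leq_mul2l hd orbT.
rewrite mulnDr mulnCA; lia.
Qed.

(* [X] stands for a sum of n terms 'C(d x, 2) and [S] for the sum of the d x. *)
Lemma Delta_bullet_ge n S X :
  (forall k b, n * k + b <= S -> n * 'C(k, 2) + k * b <= X) ->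
  n * n <= S * 2 + n -> 'C(n, 3) <= Delta_bullet n + X.
Proof.
rewrite -(odd_double_half n); move: n./2 => m.
case: (odd n); rewrite /= ?add1n ?add0n => hX hS.
  have /hX : m.*2.+1 * m + 0 <= S by lia.
  by have := Delta_bulletE_odd m; lia.
case: m hX hS => // m hX hS.
have /hX : m.+1.*2 * m + m.+1 <= S by lia.
by have := Delta_bulletE_even m; rewrite binS bin1; lia.
Qed.

(** [S] may be n below the n(n-1)/2 arcs of a tournament. Lowering each balanced out-degree d by 1
    takes d - 1 off C(d,2), in total n(n-1)/2 - n = n(n-3)/2. *)
Lemma Delta_bullet_diag_ge n S X : 3 <= n ->
  (forall k b, n * k + b <= S -> n * 'C(k, 2) + k * b <= X) ->
  n * n <= S * 2 + 3 * n ->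
  'C(n, 3) <= Delta_bullet n + (n * (n - 3)) %/ 2 + X.
Proof.
rewrite -(odd_double_half n); move: n./2 => m.
case: (odd n); rewrite /= ?add1n ?add0n => n3 hX hS.
  case: m n3 hX hS => // k _ hX hS.
  have -> : k.+1.*2.+1 * (k.+1.*2.+1 - 3) = k.+1.*2.+1 * k * 2 by lia.
  rewrite mulnK //; have /hX : k.+1.*2.+1 * k + 0 <= S by lia.
  by have := Delta_bulletE_odd k.+1; rewrite binS bin1; lia.
case: m n3 hX hS => [|[|k]] // _ hX hS.
have -> : k.+2.*2 * (k.+2.*2 - 3) = k.+2 * (k.*2.+1) * 2 by lia.
rewrite mulnK //; have /hX : k.+2.*2 * k + k.+2 <= S by lia.
by have := Delta_bulletE_even k.+1; rewrite !(binS _ 1) !bin1; lia.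
Qed.

(** * Upper bounds for [D1] and [S1] *)

Lemma star_packing_tournament n (H : {set {set 'I_n}}) (r : rel 'I_n) :
  is_cgh H -> (forall x y, r x y -> ~~ r y x) ->
  (forall e x, e \in H -> x \in e -> exists2 z, z \in e & r z x) ->
  #|H| <= Delta_bullet n.
Proof.
move=> cH ra Hr.
have := star_packing cH (completion_antisym ra).
have := Delta_bullet_ge
  (@sum_bin2_ge n (fun x => #|[set y | completion r x y]|)).
rewrite sum_outdeg_completion // => /(_ (leqnn _)) h1 h2.
rewrite -(leq_add2r (\sum_x 'C(#|[set y | completion r x y]|, 2))).
apply: leq_trans h1; apply: h2 => x e eH; apply/negP.
rewrite inE => /and3P[_ xe /subsetP sub].
have [z ze rzx] := Hr _ _ eH xe.
have zx : z != x.
  by apply: contraTneq rzx => ->; apply/negP => h; have := ra _ _ h; rewrite h.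
have := sub z; rewrite !inE zx ze => /(_ isT).
by rewrite /completion rzx orbF; apply/negP/ra.
Qed.

(** Only the side of the chord xy on the arc clockwise from [y] to [x] is seen; [apex H y x] is the
    other side. *)
Definition apex n (H : {set {set 'I_n}}) (x y : 'I_n) : {set 'I_n} :=
  [set z | cyc_order x y z && ([set x; y; z] \in H)].

(** [z] is the vertex of [e] preceding [x] clockwise. *)
Lemma apex_pred n (H : {set {set 'I_n}}) e x : is_cgh H -> e \in H -> x \in e ->
  exists y z, [/\ z \in e, y \in apex H z x & e = [set z; x; y]].
Proof.
move=> /forallP /(_ e) cH eH xe; rewrite eH in cH.
have [y [z [E c]]] := card3_cyc (eqP cH) xe.
exists y, z; split; last (by rewrite set3_rot); rewrite ?E !inE ?eqxx ?orbT //.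
by rewrite cyc_order_rot c set3_rot -E.
Qed.

Lemma D1_free_card n (H : {set {set 'I_n}}) :
  is_cgh H -> ~~ cgh_contains H D1 -> #|H| <= Delta_bullet n.
Proof.
move=> cH fH.
apply: (@star_packing_tournament _ H (fun x y => apex H x y != set0)) => //.
  move=> x y /set0Pn[z]; rewrite inE => /andP[xyz hz].
  apply: contra fH => /set0Pn[w]; rewrite inE => /andP[yxw hw].
  apply: (@contains_sorted _ 3 H [tuple x; w; y; z] x) => //=.
    rewrite andbT cdistxx.
    by move: xyz yxw; rewrite !(cyc_order_cdist x) cdistxx; lia.
  by rewrite -set3_rot.
move=> e x eH xe; have [y [z [ze h _]]] := apex_pred cH eH xe.
by exists z => //; apply/set0Pn; exists y.
Qed.

(** In clockwise order x, w, y, y', w', the triangles x w y and x y' w' would form [S1]. *)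
Lemma S1_free_apex n (H : {set {set 'I_n}}) x y y' : ~~ cgh_contains H S1 ->
  cyc_order x y y' -> apex H y x != set0 -> apex H x y' = set0.
Proof.
move=> fH xyy' /set0Pn[w]; rewrite inE => /andP[yxw hw].
apply/eqP; apply: contraNT fH => /set0Pn[w'].
rewrite inE => /andP[xyw hw'].
apply: (@contains_sorted _ 4 H [tuple x; w; y; y'; w'] x) => //=.
  by move: xyy' yxw xyw; rewrite !(cyc_order_cdist x) cdistxx; lia.
by rewrite -set3_rot.
Qed.

Lemma card_apexD n (H : {set {set 'I_n}}) x y : x != y ->
  #|apex H x y| + #|apex H y x| <= n - 2.
Proof.
move=> xy.
have dis : apex H x y :&: apex H y x = set0.
  apply/setP => z; rewrite !inE; apply/negP => /andP[/andP[h _] /andP[h' _]].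
  by move: h h'; rewrite /cyc_order; lia.
rewrite -cardsUI dis cards0 addn0.
have -> : n - 2 = #|~: [set x; y]|.
  by have := cardsC [set x; y]; rewrite cards2 xy card_ord; lia.
apply: subset_leq_card; apply/subsetP => z; rewrite !inE negb_or.
rewrite !ord_neq_ltn /cyc_order.
by case/orP => /andP[h _]; move: h; lia.
Qed.

Lemma S1_free_card n (H : {set {set 'I_n}}) :
  is_cgh H -> ~~ cgh_contains H S1 ->
  #|H| <= Delta_bullet n + (n %/ 2) * ((n - 2) %/ 2).
Proof.
move=> cH fH; pose L x y := apex H x y; pose R x y := L x y != set0.
pose win x y := R x y && (R y x ==>
  (#|L y x| < #|L x y|) || (#|L y x| == #|L x y|) && (x < y)).
pose bad := [set p | R p.1 p.2 && R p.2 p.1].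
pose lost := [set p in bad | ~~ win p.1 p.2].
have Rne x y : R x y -> x != y.
  move=> /set0Pn[z]; rewrite inE => /andP[h _]; apply: contraTneq h => ->.
  by rewrite /cyc_order; lia.
have winA x y : win x y -> ~~ win y x.
  by rewrite /win; case: (R x y); case: (R y x) => //=; lia.
(* Two chords at [x] with triangles on both sides contradict [S1_free_apex], in whichever order
   their other ends come. *)
have bad_inj : {in bad &, injective fst}.
  move=> [x y] [x' y']; rewrite !inE /= => /andP[xy yx] /andP[xy' yx'] E.
  subst x'; congr pair; apply/eqP; apply: contraT => yy'.
  have [c|c] : cyc_order x y y' \/ cyc_order x y' y.
    have [] := (Rne _ _ xy, Rne _ _ xy').
    by move: yy'; rewrite !ord_neq_ltn /cyc_order; lia.
  - by have := S1_free_apex fH c yx; move/eqP; rewrite (negbTE xy').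
  - by have := S1_free_apex fH c yx'; move/eqP; rewrite (negbTE xy).
(* [lost] and its image under swapping are disjoint subsets of [bad], which has at most n elements
   by [bad_inj]. *)
have lost_card : #|lost| <= n %/ 2.
  pose sw (p : 'I_n * 'I_n) := (p.2, p.1).
  have swK : involutive sw by case.
  have dis : lost :&: (sw @: lost) = set0.
    apply/setP => p; rewrite !inE; apply/negP => /andP[/andP[/andP[h h'] nw]].
    case/imsetP => q; rewrite !inE => /andP[_ nw'] E; move: nw nw' h h'.
    rewrite E /= /win => + + h h'; rewrite h h' /=.
    have := Rne _ _ h; by rewrite ord_neq_ltn; lia.
  have sub : lost :|: sw @: lost \subset bad.
    apply/subsetP => p; rewrite inE => /orP[|/imsetP[q + ->]];
      rewrite !inE => /andP[h _] //=; by rewrite andbC.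
  have := subset_leq_card sub; rewrite cardsU dis cards0 subn0.
  rewrite (card_imset _ (inv_inj swK)) addnn -(card_in_imset bad_inj) => h.
  have := max_card (fst @: bad); rewrite card_ord; lia.
pose H' := [set e in H | [forall x in e, exists z in e, win z x]].
have h1 : #|H'| <= Delta_bullet n.
  apply: (@star_packing_tournament _ H' win) => //.
    apply/forallP => e; apply/implyP; rewrite inE => /andP[eH _].
    by move/forallP/(_ e): cH; rewrite eH.
  by move=> e x; rewrite inE => /andP[_ /forall_inP h] /h /exists_inP.
(* A triangle outside [H'] has a vertex [x] with [win z x] for none of its [z]. For the predecessor
   [z] of [x], the pair (z, x) is then lost, and the triangle lies on its losing side. *)
have sub : H \subset H' :|: \bigcup_(p in lost)
    [set [set p.1; p.2; z] | z in L p.1 p.2].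
  apply/subsetP => e eH; rewrite !inE eH /=; case: forall_inP => //= nh.
  apply/bigcupP; have [x xe] : exists2 x, x \in e & ~~ [exists z in e, win z x].
    apply/exists_inP; rewrite -negb_forall_in; exact/forall_inP.
  rewrite negb_exists_in => /forall_inP nw.
  have [y [z [ze h E]]] := apex_pred cH eH xe.
  have rzx : R z x by apply/set0Pn; exists y.
  have nzx := nw _ ze; exists (z, x) => /=.
    rewrite !inE nzx andbT /= rzx /=; move: nzx; rewrite /win rzx /=.
    by case: (R x z).
  by apply/imsetP; exists y.
apply: leq_trans (subset_leq_card sub) _.
rewrite cardsU; apply: leq_trans (leq_subr _ _) _; apply: leq_add => //.
apply: (@leq_trans (\sum_(p in lost) ((n - 2) %/ 2))); last first.
  by rewrite sum_nat_const leq_mul2r lost_card orbT.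
apply: (@leq_trans (\sum_(p in lost)
  #|[set [set p.1; p.2; z] | z in L p.1 p.2]|)).
  elim/big_ind2: _ => [|B a C b hB hC|//]; first by rewrite cards0.
  by apply: leq_trans (leq_add hB hC); rewrite cardsU leq_subr.
apply: leq_sum => -[x y]; rewrite !inE /= => /andP[/andP[xy yx] nw].
apply: leq_trans (leq_imset_card _ _) _.
(* The losing side has no more apexes than the other, and both together have at most n - 2. *)
have := card_apexD H (Rne _ _ xy).
move: nw; rewrite /win xy yx /= -!/(L _ _). move: #|L x y| #|L y x| => i j; lia.
Qed.

(** * Upper bound for [M1] *)

Lemma M1_free_card n (H : {set {set 'I_n}}) : 3 <= n ->
  is_cgh H -> ~~ cgh_contains H M1 ->
  #|H| <= Delta_bullet n + (n * (n - 3)) %/ 2.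
Proof.
move=> n3 cH fH.
have c3 e : e \in H -> #|e| = 3.
  by move=> eH; move/forallP/(_ e): cH; rewrite eH => /eqP.
pose B p q := [exists e in H, [forall z in e, cdist p z < cdist p q]].
have BA p q : B p q -> ~~ B q p.
  case/exists_inP => e eH /forall_inP epq; apply: contra fH.
  case/exists_inP => e' eH' /forall_inP eqp.
  have [x1 [x2 [x3 [E x123]]]] := card3_sort p (c3 _ eH).
  have [x4 [x5 [x6 [E' x456]]]] := card3_sort q (c3 _ eH').
  have [h3 h4 h5 h6] : [/\ cdist p x3 < cdist p q, cdist q x4 < cdist q p,
      cdist q x5 < cdist q p & cdist q x6 < cdist q p].
    by split; [apply: epq|apply: eqp..]; rewrite ?E ?E' !inE eqxx ?orbT.
  apply: (@contains_sorted _ 5 H [tuple x1; x2; x3; x4; x5; x6] p) => //=;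
    rewrite -?E -?E' //.
  move: x123 x456; rewrite /= => /andP[-> ->] x456 /=.
  have := cdistP p x3; have := cdistP p q; have := cdistP q p.
  have := cdistP p x4; have := cdistP p x5; have := cdistP p x6.
  have := cdistP q x4; have := cdistP q x5; have := cdistP q x6.
  by have := ltn_ord q; lia.
(* [t p q] says that [p,q) is small. When neither arc contains a triangle, the
   tie-break p < q selects the arc avoiding n-1, so that subarcs of small arcs
   are small. *)
pose t := completion (fun p q => B q p).
have tA p q : t p q -> ~~ t q p by apply: completion_antisym => x y; apply: BA.
have tne p q : t p q -> q != p.
  by apply: contraTneq => ->; apply/negP => h; have := tA _ _ h; rewrite h.
pose O x y := (x != y) && t x (ordS y).
have ordSE (x : 'I_n) : ordS x = (if x.+1 == n then 0 else x.+1) :> nat.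
  rewrite /=; case: eqP => [->|]; first by rewrite modnn.
  by have := ltn_ord x => *; rewrite modn_small //; lia.
have OA x y : O x y -> ~~ O y x.
  move=> /andP[xy txy]; apply/negP => /andP[_ tyx].
  (* [v+1,u) lies inside [v,u+1), so a triangle in it would keep [v,u+1) from being small. *)
  have sub u v : u != v -> t u (ordS v) -> t v (ordS u) -> ~~ B (ordS v) u.
    move=> uv tuv tvu.
    have uv' := tne _ _ tvu; have vu' := tne _ _ tuv.
    apply/negP => /exists_inP[e eH /forall_inP h].
    have : B v (ordS u).
      apply/exists_inP; exists e => //; apply/forall_inP => z /h.
      have := cdistP (ordS v) z; have := cdistP (ordS v) u.
      have := cdistP v z; have := cdistP v (ordS u).
      move: uv uv' vu'; rewrite !ord_neq_ltn !ordSE.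
      have := ltn_ord u; have := ltn_ord v; have := ltn_ord z.
      by do 2!case: eqP; lia.
    by move: tvu => + h'; rewrite /t /completion h' (negbTE (BA _ _ h')).
  have nB := sub _ _ xy txy tyx.
  have nB' : ~~ B (ordS x) y by apply: sub tyx txy; rewrite eq_sym.
  (* Both arcs are thus small by the tie-break alone, so [x < ordS y] and [y < ordS x], impossible
     for distinct [x] and [y]. *)
  move: txy tyx; rewrite /t /completion (negbTE nB) (negbTE nB') !orFb.
  move: xy; rewrite ord_neq_ltn !ordSE => ? /andP[_ +] /andP[_ +].
  by case: eqP; case: eqP => /=; lia.
have SO : n * n <= (\sum_x #|[set y | O x y]|) * 2 + 3 * n.
  have <- := @sum_outdeg_completion n (fun p q => B q p) (fun x y => @BA y x).
  rewrite (_ : 3 * n = n * 2 + n); last lia.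
  rewrite addnA -mulnDl leq_add2r leq_mul2r /=.
  rewrite -[n in _ + n]card_ord -sum1_card -big_split /=.
  (* Up to the bijection [ordS], the out-set of [x] in [t] is contained in [O x] together with [x],
     so each vertex loses at most one. *)
  apply: leq_sum => x _.
  have -> : [set y | t x y] = @ordS n @: [set y | t x (ordS y)].
    apply/setP => y; apply/idP/imsetP => [|[z + ->]]; rewrite !inE //.
    by move=> h; exists (ord_pred y); rewrite ?inE ord_predK.
  rewrite card_imset; last exact: ordS_inj.
  rewrite addn1; apply: leq_trans (_ : #|x |: [set y | O x y]| <= _).
    apply: subset_leq_card; apply/subsetP => y; rewrite !inE /O eq_sym => ->.
    by case: eqP.
  by rewrite cardsU1; case: (_ \notin _).
rewrite -(leq_add2r (\sum_x 'C(#|[set y | O x y]|, 2))).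
apply: leq_trans (Delta_bullet_diag_ge n3 (@sum_bin2_ge n _) SO).
apply: star_packing => // x e eH; apply/negP.
rewrite inE => /and3P[_ xe /subsetP ex].
have [y [z [E xyz]]] := card3_cyc (c3 _ eH) xe.
have zx : z != x.
  apply/eqP => zx; move: xyz; rewrite zx /cyc_order; lia.
have := ex z; rewrite !inE zx E !inE eqxx orbT => /(_ isT) /andP[_ txz].
have nSzx := tne _ _ txz.
(* [z] is the last vertex of [e] clockwise from [x], so [x,z] contains [e]. By [nSzx], z + 1 is not
   [x], where the half-open arc would have length 0. *)
have : B x (ordS z).
  apply/exists_inP; exists e => //; apply/forall_inP => w.
  rewrite E !inE => we.
  have := cdistP x z; have := cdistP x y; have := cdistP x (ordS z).
  have := cdistxx x; move: xyz nSzx; rewrite (cyc_order_cdist x).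
  rewrite !ord_neq_ltn !ordSE.
  have := ltn_ord z; have := ltn_ord x.
  by case: eqP; case/orP: we => [/orP[]|] /eqP ->; lia.
by move=> h; move: txz; rewrite /t /completion h (negbTE (BA _ _ h)).
Qed.

(** * Lower bounds from far triangles *)

Lemma card_cdist_le n (x : 'I_n) k : #|[set y | 0 < cdist x y <= k]| <= k.
Proof.
have u : uniq (map (cdist x) (enum [set y | 0 < cdist x y <= k])).
  by rewrite map_inj_uniq ?enum_uniq //; apply: cdist_inj.
rewrite cardE -(size_map (cdist x)) -[leqRHS](size_iota 1).
apply: uniq_leq_size u _ => i /mapP[y]; rewrite mem_enum inE => h ->.
by rewrite mem_iota; lia.
Qed.

Lemma sum_bin2_step n a b : b <= n ->
  \sum_(x < n) 'C(a + (x < b), 2) = n * 'C(a, 2) + a * b.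
Proof.
move=> bn; have E (x : 'I_n) : 'C(a + (x < b), 2) = 'C(a, 2) + a * (x < b).
  by case: (x < b); rewrite ?addn1 ?addn0 ?binS ?bin1 ?muln1 ?muln0 //; lia.
under eq_bigr => x _ do rewrite E.
rewrite big_split /= sum_nat_const card_ord -big_distrr /=; congr (_ + _ * _).
have -> : \sum_(x < n) (x < b) = \sum_(x < n | x < b) 1.
  by rewrite [RHS]big_mkcond; apply: eq_bigr => x _; case: (x < b).
by rewrite -(big_ord_widen n (fun=> 1) bn) sum_nat_const card_ord muln1.
Qed.

(** The threshold h is a + 1 on the first [b] vertices and a on the others. *)
Definition far_triangles n (H : {set {set 'I_n}}) a b := forall x y z,
  cyc_order x y z -> [set x; y; z] \in H -> a + (x < b) < cdist x z.

(** Remove for each [x] the star on the next h x vertices, at a cost of at most C(h x, 2); what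
    remains is far. *)
Lemma ex_cyc_ge n k (F : {set {set 'I_k}}) a b : b <= n ->
  (forall H : {set {set 'I_n}},
     far_triangles H a b -> ~~ cgh_contains H F) ->
  'C(n, 3) <= ex_cyc n F + (n * 'C(a, 2) + a * b).
Proof.
move=> bn hF; pose A (x : 'I_n) := [set y | 0 < cdist x y <= a + (x < b)].
have irr x : x \notin A x by rewrite inE cdistxx.
apply: leq_trans (star_covering irr) _; apply: leq_add; last first.
  rewrite -(sum_bin2_step _ bn); apply: leq_sum => x _.
  by apply: leq_bin2l; apply: card_cdist_le.
set H := _ :\: _; rewrite /ex_cyc.
apply: (bigmax_sup H) => //; apply/andP; split.
  by apply/forallP => e; apply/implyP; rewrite !inE => /andP[].
apply: hF => x y z xyz; rewrite !inE => /andP[+ c3]; apply: contraR.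
rewrite -leqNgt => zx; apply/bigcupP; exists x => //.
rewrite inE c3 !inE eqxx /=; apply/subsetP => w; rewrite !inE => /andP[wx].
move: xyz wx; rewrite (cyc_order_cdist x) cdistxx => h.
by move/negbTE => -> /orP[] /eqP ->; lia.
Qed.

Lemma ex_cycE n k (F : {set {set 'I_k}}) m :
  (forall H : {set {set 'I_n}}, is_cgh H -> ~~ cgh_contains H F -> #|H| <= m) ->
  m <= ex_cyc n F -> ex_cyc n F = m.
Proof.
move=> h1 h2; apply/eqP; rewrite eqn_leq h2 andbT.
by apply/bigmax_leqP => H /andP[]; apply: h1.
Qed.

(** The two lengths of the common side sum to n and both exceed a. For n = 2a + 2 its ends are
    antipodal, so one has index below b = n/2 and needs more than a + 1. *)
Lemma far_D1_free n (H : {set {set 'I_n}}) a b :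
  n = a.*2.+1 \/ n = a.+1.*2 /\ b = a.+1 ->
  far_triangles H a b -> ~~ cgh_contains H D1.
Proof.
move=> nab hH; apply/negP => /containsP[g [gc h1 h2]].
have c1 := gc 0 1 2 isT isT; have c2 := gc 0 2 3 isT isT.
rewrite set3_rot in h2; rewrite cyc_order_rot in c2.
have := hH _ _ _ c1 h1; have := hH _ _ _ c2 h2.
have := cdistP (g 0) (g 2); have := cdistP (g 2) (g 0).
have := ltn_ord (g 0); have := ltn_ord (g 2); lia.
Qed.

(** The arcs from [g 0] to [g 2] and from [g 3] to [g 0] exceed a, and a gap of at least 1 separates
    them. For n = 2a + 3 this is tight, so [g 0] and [g 3] are among the last a + 1 vertices, where
    no clockwise distance is a + 1. *)
Lemma far_S1_free n (H : {set {set 'I_n}}) a b :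
  n = a.+1.*2 \/ n = a.+1.*2.+1 /\ b = a.+2 ->
  far_triangles H a b -> ~~ cgh_contains H S1.
Proof.
move=> nab hH; apply/negP => /containsP[g [gc h1 h2]].
have c1 := gc 0 1 2 isT isT; have c2 := gc 0 3 4 isT isT.
have := gc 0 2 3 isT isT; rewrite /cyc_order => c3.
rewrite set3_rot in h2; rewrite cyc_order_rot in c2.
have := hH _ _ _ c1 h1; have := hH _ _ _ c2 h2.
have := cdistP (g 0) (g 2); have := cdistP (g 3) (g 0).
have := ltn_ord (g 0); have := ltn_ord (g 2); have := ltn_ord (g 3); lia.
Qed.

(** Two arcs longer than a are separated by two gaps. For n = 2a + 4 this is tight and makes [g 0]
    and [g 3] antipodal, so one has index below b = n/2 and needs a longer arc. *)
Lemma far_M1_free n (H : {set {set 'I_n}}) a b :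
  n = a.+1.*2.+1 \/ n = a.+2.*2 /\ b = a.+2 ->
  far_triangles H a b -> ~~ cgh_contains H M1.
Proof.
move=> nab hH; apply/negP => /containsP[g [gc h1 h2]].
have := hH _ _ _ (gc 0 1 2 isT isT) h1; have := hH _ _ _ (gc 3 4 5 isT isT) h2.
have := gc 0 2 3 isT isT; have := gc 2 3 5 isT isT; have := gc 0 3 5 isT isT.
have := cdistP (g 0) (g 2); have := cdistP (g 3) (g 5); rewrite /cyc_order.
have := ltn_ord (g 0); have := ltn_ord (g 2); have := ltn_ord (g 3).
have := ltn_ord (g 5); lia.
Qed.

(** * Matching the bounds for odd and even n *)

Theorem theorem2 (n : nat) (hn : 3 <= n) :
  [/\ ex_cyc n D1 = Delta_bullet n,
      ex_cyc n S1 = Delta_bullet n + (n %/ 2) * ((n - 2) %/ 2)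
    & ex_cyc n M1 = Delta_bullet n + (n * (n - 3)) %/ 2].
Proof.
have lower k (F : {set {set 'I_k}}) a b : b <= n ->
    (forall H : {set {set 'I_n}}, far_triangles H a b -> ~~ cgh_contains H F) ->
    'C(n, 3) <= ex_cyc n F + (n * 'C(a, 2) + a * b) by apply: ex_cyc_ge.
have [m] : exists m, n = m.+1.*2.+1 \/ n = m.+2.*2.
  exists (n.-1./2).-1; have := odd_double_half n; lia.
case=> nE; split; apply: ex_cycE.
- exact: D1_free_card.
- have := lower _ D1 m.+1 0 isT (fun H => far_D1_free (or_introl nE)).
  by have := Delta_bulletE_odd m.+1; rewrite nE; lia.
- exact: S1_free_card.
(* Compared with threshold m + 1 everywhere, threshold m gains nm triples; raising it at m + 2
   vertices costs m(m + 2), leaving m(m + 1). *)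
- have := lower _ S1 m m.+2 ltac:(lia)
    (fun H => far_S1_free (or_intror (conj nE erefl))).
  have -> : n %/ 2 * ((n - 2) %/ 2) = m.+1 * m by congr (_ * _); lia.
  by have := Delta_bulletE_odd m.+1; rewrite nE binS bin1; lia.
- by move=> H; apply: M1_free_card.
- have := lower _ M1 m 0 isT (fun H => far_M1_free (or_introl nE)).
  have -> : n * (n - 3) %/ 2 = n * m.
    by rewrite (_ : n * (n - 3) = n * m * 2) ?mulnK // nE; lia.
  by have := Delta_bulletE_odd m.+1; rewrite nE binS bin1; lia.
- exact: D1_free_card.
- have := lower _ D1 m.+1 m.+2 ltac:(lia)
    (fun H => far_D1_free (or_intror (conj nE erefl))).
  by have := Delta_bulletE_even m.+1; rewrite nE [in 'C(m.+2, 2)]binS bin1; lia.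
- exact: S1_free_card.
- have := lower _ S1 m.+1 0 isT (fun H => far_S1_free (or_introl nE)).
  have -> : n %/ 2 * ((n - 2) %/ 2) = m.+2 * m.+1 by congr (_ * _); lia.
  by have := Delta_bulletE_even m.+1; rewrite nE [in 'C(m.+2, 2)]binS bin1; lia.
- by move=> H; apply: M1_free_card.
- have := lower _ M1 m m.+2 ltac:(lia)
    (fun H => far_M1_free (or_intror (conj nE erefl))).
  have -> : n * (n - 3) %/ 2 = m.+2 * m.*2.+1.
    by rewrite (_ : n * (n - 3) = m.+2 * m.*2.+1 * 2) ?mulnK // nE; lia.
  by have := Delta_bulletE_even m.+1; rewrite nE !(binS _ 1) !bin1; lia.
Qed.
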